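(* Let $A$ be an injective real matrix of size $K'\times M$, let $\sigma>0$, let $y\in\mathbb{R}^M$, let $\epsilon\sim\mathcal{N}(0,\sigma^2 I_M)$, and let $\mathcal{L}:\mathbb{R}^M\to\mathbb{R}$ be defined by $\mathcal{L}(x)=\mathbb{E}\left[\left(\|A(x+\epsilon)\|^2-\|Ay\|^2\right)^2\right]$. Define $$\Lambda=\left\{\lambda\in\mathrm{sp}(A^TA)\ :\ \|Ay\|^2-\mathbb{E}\left[\|A\epsilon\|^2\right]-2\sigma^2\lambda\geq 0\right\}.$$ If $\Lambda=\emptyset$, then $\mathcal{L}$ has a unique global minimizer, equal to $0$. If $\Lambda\neq\emptyset$, then the global minimizers of $\mathcal{L}$ are exactly the vectors $x\in\mathbb{R}^M$ in the eigenspace of $A^TA$ associated with the eigenvalue $\min\Lambda$ (that is, $A^TAx=(\min\Lambda)\,x$) such that $$\|Ax\|^2=\|Ay\|^2-\mathbb{E}\left[\|A\epsilon\|^2\right]-2\sigma^2\min\Lambda.$$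
   Context: $\|\cdot\|$ is the Euclidean norm, $\mathrm{sp}(B)$ is the set of eigenvalues of a matrix $B$, and $I_M$ is the $M\times M$ identity matrix. The function $\mathcal{L}$ is the loss $\mathcal{L}(x)=\mathbb{E}_{\epsilon\sim p(\epsilon_0)}[\|\phi(x+\epsilon)-\phi(y)\|^2]$ for the representation $\phi(x)=\|Ax\|^2$ and noise $\epsilon_0\sim\mathcal{N}(0,\sigma^2I_M)$; $y$ is fixed (deterministic). *)

(* Defs.v *)
From HB Require Import structures.
From mathcomp Require Import all_boot all_order all_algebra.
From mathcomp Require Import all_classical all_reals all_analysis.
Import Order.TTheory GRing.Theory Num.Theory.
Import numFieldNormedType.Exports.

Set Implicit Arguments.
Unset Strict Implicit.
Unset Printing Implicit Defensive.

Local Open Scope classical_set_scope.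
Local Open Scope ring_scope.

(* The library norm on matrices is the sup norm, hence this definition. *)
Definition enorm (R : realType) (n : nat) (v : 'cV[R]_n) : R :=
  Num.sqrt (\sum_(i < n) v i 0 ^+ 2).

Definition mutually_independent (d : measure_display) (T : measurableType d)
    (R : realType) (P : probability T R) (n : nat) (X : 'I_n -> T -> R) : Prop :=
  forall (J : {set 'I_n}) (B : 'I_n -> set R),
    (forall i, measurable (B i)) ->
    P (\bigcap_(i in [set` J]) (X i @^-1` B i)) =
    (\prod_(i in J) P (X i @^-1` B i))%E.

(* eps ~ N(0, sigma ^+ 2 I_M), i.e., the coordinates of eps are independent
   random variables of law N(0, sigma ^+ 2). The second parameter of
   [normal_prob] is the standard deviation. Laws are compared on measurable
   sets only: the values of a measure elsewhere are meaningless. *)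
Definition isotropic_gaussian (d : measure_display) (T : measurableType d)
    (R : realType) (P : probability T R) (M : nat) (sigma : R)
    (eps : T -> 'cV[R]_M) : Prop :=
  [/\ forall i, measurable_fun [set: T] (fun w => eps w i 0),
      forall i (B : set R), measurable B ->
        P ((fun w => eps w i 0) @^-1` B) = normal_prob 0 sigma B
    & mutually_independent P (fun i w => eps w i 0)].

(* [fine] loses nothing in the following two definitions: Gaussian vectors have
   finite moments of all orders. *)
Definition loss (d : measure_display) (T : measurableType d) (R : realType)
    (P : probability T R) (K M : nat) (A : 'M[R]_(K, M))
    (eps : T -> 'cV[R]_M) (y x : 'cV[R]_M) : R :=
  fine 'E_P[fun w =>
    (enorm (A *m (x + eps w)) ^+ 2 - enorm (A *m y) ^+ 2) ^+ 2].

Definition noise_energy (d : measure_display) (T : measurableType d)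
    (R : realType) (P : probability T R) (K M : nat) (A : 'M[R]_(K, M))
    (eps : T -> 'cV[R]_M) : R :=
  fine 'E_P[fun w => enorm (A *m eps w) ^+ 2].

Definition sp (R : realType) (n : nat) (B : 'M[R]_n) : set R :=
  [set l | eigenvalue B l].

Definition Lambda (d : measure_display) (T : measurableType d) (R : realType)
    (P : probability T R) (K M : nat) (A : 'M[R]_(K, M)) (sigma : R)
    (eps : T -> 'cV[R]_M) (y : 'cV[R]_M) : set R :=
  [set l | sp (A^T *m A) l /\
    enorm (A *m y) ^+ 2 - noise_energy P A eps - 2 * sigma ^+ 2 * l >= 0].

Definition is_min (R : realType) (S : set R) (m : R) : Prop :=
  S m /\ lbound S m.

Definition global_minimizers (R : realType) (X : Type) (f : X -> R) : set X :=
  [set x | forall z, f x <= f z].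

(* Main.v *)
(** Expanding the square, the odd moments of the noise drop out, because the law
    of [eps] is invariant under sign changes of its coordinates, and, with
    [S = A^T A] and [t = |Ay|^2 - E |A eps|^2],
      [L(x) = (|Ax|^2 - t)^2 + 4 sigma^2 |Sx|^2 + const].
    If [l] is the smallest eigenvalue of [S], then [|Sx|^2 >= l |Ax|^2], with
    equality iff [Sx = l x], so with [r = t - 2 sigma^2 l] and [u = |Ax|^2] the
    loss is [(u - r)^2 + 4 sigma^2 (|Sx|^2 - l u)] up to a constant: for
    [r >= 0] both terms can be made to vanish along the eigenspace of [l],
    and for [r < 0] the best choice is [u = 0]. *)

Require Import Defs.
From mathcomp Require Import all_boot all_order all_algebra.
From mathcomp Require Import all_classical all_reals all_analysis.
From mathcomp Require Import measurable_realfun ring lra.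
Import Order.TTheory GRing.Theory Num.Theory.
Import numFieldNormedType.Exports.
Import HBNNSimple.
Set Implicit Arguments.
Unset Strict Implicit.
Unset Printing Implicit Defensive.
Local Open Scope classical_set_scope.
Local Open Scope ring_scope.

(** * Moments of the normal law *)

Section Density.
Local Open Scope ereal_scope.

(** By monotone convergence along simple functions increasing to [f], both sides are limits of
    integrals of simple functions; by linearity these reduce to indicators, where the identity is
    the assumption on [nu]. *)
Lemma ge0_integral_density (d : measure_display) (T : measurableType d)
    (R : realType) (mu nu : {measure set T -> \bar R}) (g : T -> \bar R)
    (f : T -> \bar R) :
  measurable_fun setT g -> (forall x, 0 <= g x) -> (forall x, g x \is a fin_num) ->
  (forall A, measurable A -> nu A = \int[mu]_(x in A) g x) ->
  measurable_fun setT f -> (forall x, 0 <= f x) ->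
  \int[nu]_x f x = \int[mu]_x (f x * g x).
Proof.
move=> mg g0 gfin nug mf f0.
pose h := nnsfun_approx measurableT mf.
have fE x : f x = lim ((EFin \o h n) x @[n --> \oo]).
  by apply/esym/cvg_lim => //; exact: cvg_nnsfun_approx.
have -> : \int[nu]_x f x = lim (\int[nu]_x (EFin \o h n) x @[n --> \oo]).
  under eq_integral => x _ do rewrite fE.
  apply: monotone_convergence => //.
  - by move=> n; apply/measurable_EFinP; exact/measurable_funP.
  - by move=> n x _ /=; rewrite lee_fin.
  - by move=> x _ a b ab; rewrite lee_fin; exact/lefP/nd_nnsfun_approx.
have -> : \int[mu]_x (f x * g x) =
    lim (\int[mu]_x ((EFin \o h n) \* g) x @[n --> \oo]).
  have fg x : f x * g x = lim (((EFin \o h n) \* g) x @[n --> \oo]).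
    by apply/esym/cvg_lim => //; apply: cvgeZr => //; exact: cvg_nnsfun_approx.
  under eq_integral => x _ do rewrite fg.
  apply: monotone_convergence => [//| | |].
  - by move=> n; apply/emeasurable_funM => //; exact/measurable_EFinP.
  - by move=> n x _ /=; rewrite mule_ge0 ?lee_fin.
  - move=> x _ a b ab/=; rewrite lee_wpmul2r ?lee_fin//.
    exact/lefP/nd_nnsfun_approx.
congr (limn _); apply/funext => n /=.
have indich r : measurable_fun setT (fun x => (r * \1_(h n @^-1` [set r]) x)%:E).
  by apply: measurableT_comp => //; exact: measurable_funM.
under eq_integral => x _ do rewrite fimfunE -fsumEFin//.
under [RHS]eq_integral => x _.
  rewrite fimfunE -fsumEFin// ge0_mule_fsuml; last first.
    by move=> r; exact: nnfun_muleindic_ge0.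
  over.
rewrite !ge0_integral_fsum//; last 3 first.
- by move=> r; exact: emeasurable_funM.
- by move=> r x _; rewrite mule_ge0// nnfun_muleindic_ge0.
- by move=> r x _; exact: nnfun_muleindic_ge0.
(* Only attained values [h n t] occur as coefficients, so they are nonnegative and can leave the
   integral. *)
apply: eq_fsbigr => r; rewrite inE => -[t _ <-].
under eq_integral do rewrite EFinM.
rewrite integralZl_indic_nnsfun//.
under [RHS]eq_integral do rewrite EFinM -muleA.
rewrite ge0_integralZl//.
- congr (_ * _); rewrite integral_indic// setIT nug// [LHS]integral_mkcond.
  by apply: eq_integral => x _; rewrite muleC epatch_indic.
- by apply: emeasurable_funM => //; exact/measurable_EFinP.
- by move=> x _; rewrite mule_ge0 ?lee_fin.
- by rewrite lee_fin.
Qed.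

End Density.

Section NormalMoments.
Context {R : realType}.
Implicit Types s h : R.
Local Notation mu := (@lebesgue_measure R).

(** Change of variables [x -> - x]: Lebesgue measure is reflection invariant and the centered
    density is even. *)
Lemma normal_probN s (B : set R) : s != 0 -> measurable B ->
  normal_prob 0 s (-%R @^-1` B) = normal_prob 0 s B.
Proof.
move=> s0 mB; rewrite /normal_prob.
pose f (x : measurableTypeR R) := (normal_pdf 0 s x)%:E.
have mf : measurable_fun B f.
  by apply/measurable_EFinP/measurable_funTS; exact: measurable_normal_pdf.
have f0 : {in B, forall y, 0 <= f y}%E.
  by move=> y _; rewrite lee_fin normal_pdf_ge0.
pose N : measurableTypeR R -> measurableTypeR R := -%R.
have mN : measurable_fun setT N by exact: oppr_measurable.
have := ge0_integral_pushforward mN mu mB mf f0.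
rewrite [LHS](eq_measure_integral mu); last first.
  by move=> A mA _; exact: (lebesgue_measureN mA).
move=> ->; apply: eq_integral => x _ /=; congr EFin.
by rewrite /normal_pdf (negbTE s0) /normal_fun !subr0 sqrrN.
Qed.

(* Multiplying by [expR (h * x ^+ 2)] turns the Gaussian weight of standard
   deviation [s] into that of [s / Num.sqrt (1 - 2 * h * s ^+ 2)]. *)
Lemma normal_exp_sqr s h : 0 < s -> 2 * h * s ^+ 2 < 1 ->
  (\int[normal_prob 0 s]_x (expR (h * x ^+ 2))%:E)%E =
    (Num.sqrt (1 - 2 * h * s ^+ 2))^-1%:E.
Proof.
move=> s0 hs.
pose q := Num.sqrt (1 - 2 * h * s ^+ 2).
have q0 : 0 < q by rewrite sqrtr_gt0 subr_gt0.
have q2 : q ^+ 2 = 1 - 2 * h * s ^+ 2 by rewrite sqr_sqrtr// subr_ge0 ltW.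
rewrite -/q (@ge0_integral_density _ _ _ mu _ (EFin \o normal_pdf 0 s))//; last 3 first.
- by apply/measurable_EFinP; exact: measurable_normal_pdf.
- by move=> x /=; rewrite lee_fin normal_pdf_ge0.
- apply/measurable_EFinP; apply: measurableT_comp => //.
  by apply: measurable_funM => //; exact: measurable_funX.
have s10 : s / q != 0 by rewrite mulf_neq0 ?invr_eq0 ?gt_eqF.
(* The peak is inversely proportional to the standard deviation; this ratio is the factor [q^-1] of
   the result. *)
have peakE : normal_peak s = q^-1 * normal_peak (s / q).
  rewrite /normal_peak -invfM; congr (_^-1).
  rewrite -{1}[q]gtr0_norm// -sqrtr_sqr -sqrtrM ?sqr_ge0//; congr Num.sqrt.
  by rewrite -!mulrnAr; field; rewrite gt_eqF.
transitivity ((q^-1)%:E * \int[mu]_x (normal_pdf 0 (s / q) x)%:E)%E.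
  rewrite -ge0_integralZl//; last 3 first.
  - by apply/measurable_EFinP; exact: measurable_normal_pdf.
  - by move=> x _; rewrite lee_fin normal_pdf_ge0.
  - by rewrite lee_fin invr_ge0 ltW.
  apply: eq_integral => x _; rewrite -!EFinM; congr EFin.
  rewrite /normal_pdf (negbTE s10) gt_eqF// peakE mulrCA -mulrA; congr (_ * (_ * _)).
  (* The exponents agree: h x^2 - x^2 / (2 s^2) = - q^2 x^2 / (2 s^2). *)
  rewrite /normal_fun -expRD; congr expR.
  rewrite !subr0 expr_div_n q2; field.
  by rewrite -q2 !gt_eqF ?exprn_gt0.
by rewrite integral_normal_pdf mule1.
Qed.

Lemma integrable_normal_expr4 s : 0 < s ->
  (normal_prob 0 s).-integrable setT (fun x => (x ^+ 4)%:E).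
Proof.
(* Half of the critical value 1 / (2 s^2), so that the exponential moment is finite. *)
move=> s0; pose h := (4 * s ^+ 2)^-1.
have s20 : 0 < s ^+ 2 by rewrite exprn_gt0.
have h0 : 0 < h by rewrite invr_gt0 mulr_gt0.
have hs : 2 * h * s ^+ 2 < 1.
  have -> : 2 * h * s ^+ 2 = 2^-1 by rewrite /h; field; rewrite gt_eqF.
  by rewrite invf_lt1// ltr1n.
have mexp : measurable_fun setT (fun x : R => (expR (h * x ^+ 2))%:E).
  apply/measurable_EFinP; apply: measurableT_comp => //.
  by apply: measurable_funM => //; exact: measurable_funX.
apply/integrableP; split.
  by apply/measurable_EFinP; exact: measurable_funX.
have /le_lt_trans -> // :
  (\int[normal_prob 0 s]_x `|(x ^+ 4)%:E| <=
   (2 / h ^+ 2)%:E * \int[normal_prob 0 s]_x (expR (h * x ^+ 2))%:E)%E; last first.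
  by rewrite normal_exp_sqr// -EFinM ltry.
rewrite -ge0_integralZl//; last first.
- by rewrite lee_fin divr_ge0// exprn_ge0// ltW.
apply: ge0_le_integral => //.
- apply/measurable_EFinP/measurableT_comp => //; exact: measurable_funX.
- exact: measurable_funeM.
- move=> x _; rewrite -EFinM lee_fin ger0_norm ?exprn_even_ge0//.
  have hx0 : 0 <= h * x ^+ 2 by rewrite mulr_ge0 ?sqr_ge0// ltW.
  (* With z = h x^2 >= 0, the bound e^z >= z^2 / 2 gives x^4 = z^2 / h^2 <= (2 / h^2) e^z. *)
  have := expR_ge1Dxn 1 hx0; rewrite /= => ex.
  rewrite mulrAC ler_pdivlMr ?exprn_gt0//.
  by rewrite (_ : 2`!%:R = 2 :> R) in ex => //; lra.
Qed.

Lemma integrable_normal_sqr s : 0 < s ->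
  (normal_prob 0 s).-integrable setT (fun x => (x ^+ 2)%:E).
Proof.
move=> s0.
have h : (normal_prob 0 s).-integrable setT (EFin \o (cst 1 \+ fun x : R => x ^+ 4)).
  rewrite /comp; under eq_fun do rewrite /= EFinD.
  apply: integrableD => //; first exact: finite_measure_integrable_cst.
  exact: integrable_normal_expr4.
apply: le_integrable h => //.
  by apply/measurable_EFinP; exact: measurable_funX.
move=> x _; rewrite lee_fin /= !ger0_norm ?addr_ge0 ?exprn_even_ge0//.
have := sqr_ge0 (x ^+ 2 - 1); have := sqr_ge0 (x ^+ 2); nra.
Qed.

(* To first order in [h] the inequality reads [h * m <= h * v], and [h] may take
   both signs. In the proof [h] is the multiple [(m - v) / W], where [W] collects
   the smallness conditions that control the higher-order terms. *)
Lemma eq_of_le_invsqrt (m v : R) : 0 <= m -> 0 < v ->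
  (forall h, 2 * h * v < 1 -> 1 + h * m <= (Num.sqrt (1 - 2 * h * v))^-1) ->
  m = v.
Proof.
move=> m0 v0 hm; apply/eqP; rewrite -subr_eq0; apply/negPn/negP => D0.
set D := m - v in D0.
have nD : 0 < `|D| by rewrite normr_gt0.
pose W := 1 + 4 * m * v + 2 * `|D| * m ^+ 2 * v + 2 * `|D| * v + `|D| * m.
have p1 : 0 <= m * v by rewrite mulr_ge0// ltW.
have p2 : 0 <= `|D| * m ^+ 2 * v by rewrite !mulr_ge0// ?sqr_ge0// ltW.
have p3 : 0 < `|D| * v by rewrite mulr_gt0.
have p4 : 0 <= `|D| * m by rewrite mulr_ge0.
have W1 : 1 < W by rewrite /W; lra.
have W0 : 0 < W by lra.
pose t := W^-1.
have t0 : 0 < t by rewrite invr_gt0.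
have t1 : t < 1 by rewrite invf_lt1.
have tW : t * W = 1 by rewrite mulVf// gt_eqF.
have tb a : 0 <= a -> a <= W -> t * a <= 1.
  by move=> a0 aW; rewrite -tW ler_wpM2l// ltW.
pose h := t * D.
have nh : `|h| = t * `|D| by rewrite normrM gtr0_norm.
have h1 : 2 * h * v < 1.
  have : h * v <= t * (`|D| * v).
    by rewrite mulrA -nh ler_wpM2r ?ler_norm// ltW.
  have : t * (2 * (`|D| * v)) < 1.
    by rewrite -[ltRHS]tW ltr_pM2l// /W; lra.
  lra.
have h2 : 0 <= 1 + h * m.
  have : `|h * m| <= 1.
    by rewrite normrM nh (ger0_norm m0) -mulrA tb// /W; lra.
  by rewrite ler_norml; lra.
have q0 : 0 < 1 - 2 * h * v by lra.
have q20 : 0 < Num.sqrt (1 - 2 * h * v) by rewrite sqrtr_gt0.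
have key : (1 + h * m) ^+ 2 * (1 - 2 * h * v) <= 1.
  rewrite -(sqr_sqrtr (ltW q0)) -exprMn expr_le1 ?mulr_ge0 ?sqrtr_ge0//.
  by rewrite -ler_pdivlMr// mul1r hm.
(* Expand [key] and drop the nonnegative term h^2 m^2 on the left. *)
have k2 : 2 * h * D <= h ^+ 2 * (4 * m * v) + 2 * h * h ^+ 2 * m ^+ 2 * v.
  have : 0 <= h ^+ 2 * m ^+ 2 by rewrite mulr_ge0 ?sqr_ge0.
  rewrite /D; nra.
have k3 : h * h ^+ 2 * m ^+ 2 * v <= h ^+ 2 * (`|D| * m ^+ 2 * v).
  have hD : h <= `|D| by rewrite (le_trans (ler_norm _))// nh ler_piMl ?ltW.
  have p0 : 0 <= h ^+ 2 * m ^+ 2 * v.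
    by apply: mulr_ge0; [apply: mulr_ge0; exact: sqr_ge0|exact: ltW].
  have := ler_wpM2r p0 hD; lra.
have k4 : t * (2 * D ^+ 2) <= t * (D ^+ 2 * (t * (4 * m * v + 2 * `|D| * m ^+ 2 * v))).
  have -> : t * (2 * D ^+ 2) = 2 * h * D by rewrite /h; ring.
  have -> : t * (D ^+ 2 * (t * (4 * m * v + 2 * `|D| * m ^+ 2 * v))) =
    h ^+ 2 * (4 * m * v) + 2 * (h ^+ 2 * (`|D| * m ^+ 2 * v)) by rewrite /h; ring.
  lra.
have D20 : 0 < D ^+ 2 by rewrite exprn_even_gt0.
(* Dividing by t D^2 leaves 2 <= t (4 m v + 2 |D| m^2 v), but the right-hand side is at most t W =
   1. *)
move: k4; rewrite (ler_pM2l t0) mulrC (ler_pM2l D20).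
have := tb (4 * m * v + 2 * `|D| * m ^+ 2 * v).
rewrite /W => /(_ _ _)/[swap]; lra.
Qed.

(** Let m be the second moment. Integrating 1 + h x^2 <= exp (h x^2) gives 1 + h m <= (1 - 2 h
    s^2)^(-1/2) whenever 2 h s^2 < 1, and [eq_of_le_invsqrt] extracts m from this family of
    inequalities. *)
Lemma normal_second_moment s : 0 < s ->
  (\int[normal_prob 0 s]_x (x ^+ 2)%:E = (s ^+ 2)%:E)%E.
Proof.
move=> s0; have i2 := integrable_normal_sqr s0.
have fin2 := integrable_fin_num measurableT i2.
rewrite -(fineK fin2); congr EFin.
apply: eq_of_le_invsqrt.
- by rewrite fine_ge0// integral_ge0// => x _; rewrite lee_fin sqr_ge0.
- by rewrite exprn_gt0.
move=> h hs; rewrite -lee_fin -normal_exp_sqr// EFinD EFinM fineK//.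
rewrite -integralZl//.
have -> : 1%:E = (\int[normal_prob 0 s]_x (cst 1 x))%E.
  rewrite integral_cst// mul1e; symmetry.
  exact: (@probability_setT _ _ _ (normal_prob 0 s)).
rewrite -integralD//; last 2 first.
- exact: finite_measure_integrable_cst.
- exact: integrableZl.
have me : measurable_fun setT (fun x : R => (expR (h * x ^+ 2))%:E).
  apply/measurable_EFinP; apply: measurableT_comp => //.
  by apply: measurable_funM => //; exact: measurable_funX.
apply: le_integral => //.
- apply: integrableD => //; first exact: finite_measure_integrable_cst.
  exact: integrableZl.
- apply/integrableP; split => //.
  under eq_integral do rewrite gee0_abs ?lee_fin ?expR_ge0//.
  by rewrite normal_exp_sqr// ltry.
- by move=> x _; rewrite -EFinM -EFinD lee_fin expR_ge1Dx.
Qed.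

End NormalMoments.

(** * Joint laws of independent variables *)

Section tuple_rectangles.
Context (d : measure_display) (T : measurableType d) (n : nat).

(** Measurable boxes form a pi-system generating the product sigma-algebra, so they determine joint
    laws. *)
Definition tuple_rectangles : set (set (n.-tuple T)) :=
  [set A | exists2 B : 'I_n -> set T, (forall i, measurable (B i)) &
    A = \bigcap_i ((fun t : n.-tuple T => tnth t i) @^-1` B i)].

Lemma tuple_rectanglesT : tuple_rectangles setT.
Proof.
exists (fun=> setT); first by move=> i; exact: measurableT.
by apply/seteqP; split.
Qed.

Lemma tuple_rectanglesI : setI_closed tuple_rectangles.
Proof.
move=> _ _ [B mB ->] [C mC ->]; exists (fun i => B i `&` C i).
  by move=> i; exact: measurableI.
apply/seteqP; split => [t [Bt Ct] i _|t BCt].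
  by split; [exact: Bt|exact: Ct].
by split => i _; have [] := BCt i I.
Qed.

Lemma measurable_tuple_rectangles :
  @measurable _ (n.-tuple T) = <<s tuple_rectangles >>.
Proof.
apply/seteqP; split; apply: smallest_sub.
- exact: smallest_sigma_algebra.
- rewrite -bigcup_seq/= => _ [i _ [B mB <-]]; apply: sub_sigma_algebra.
  (* A cylinder over coordinate [i] is the box whose other sides are full. *)
  exists (fun j => if j == i then B else setT).
    by move=> j; case: ifP => // _; exact: measurableT.
  rewrite setTI; apply/seteqP; split => [t Bt j _ /=|t /(_ i I)].
    by case: eqP => // ->.
  by rewrite /= eqxx.
- exact: sigma_algebra_measurable.
- move=> _ [B mB ->]; apply: fin_bigcap_measurable => // i _.
  by rewrite -[X in measurable X]setTI; exact: measurable_tnth.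
Qed.

End tuple_rectangles.

Section joint_law.
Context (d : measure_display) (T : measurableType d) (R : realType).
Variables (P : probability T R) (n : nat).
Implicit Types X Y : 'I_n -> T -> R.

Definition joint X (w : T) : n.-tuple (measurableTypeR R) := [tuple X i w | i < n].

Lemma measurable_joint X : (forall i, measurable_fun setT (X i)) ->
  measurable_fun setT (joint X).
Proof.
move=> mX; apply/measurable_fun_tnthP => i.
rewrite (_ : _ \o _ = X i); first exact: mX.
by apply/funext => w /=; rewrite tnth_mktuple.
Qed.

(** On a box, independence turns both probabilities into products of equal marginal probabilities;
    uniqueness of measures on a pi-system does the rest. *)
Lemma joint_law_unique X Y :
  (forall i, measurable_fun setT (X i)) ->
  (forall i, measurable_fun setT (Y i)) ->
  mutually_independent P X -> mutually_independent P Y ->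
  (forall i (B : set R), measurable B -> P (X i @^-1` B) = P (Y i @^-1` B)) ->
  forall A, measurable A -> P (joint X @^-1` A) = P (joint Y @^-1` A).
Proof.
move=> mX mY iX iY XY A mA.
have mjX := measurable_joint mX; have mjY := measurable_joint mY.
have XE Z (B : 'I_n -> set R) :
    joint Z @^-1` (\bigcap_i ((fun t => tnth t i) @^-1` B i)) =
    \bigcap_(i in [set` [set: 'I_n]%SET]) (Z i @^-1` B i).
  apply/seteqP; split => w Bw i.
    by move=> _ /=; have := Bw i I; rewrite /= tnth_mktuple.
  by move=> _ /=; rewrite tnth_mktuple; apply: Bw; rewrite /= finset.in_setT.
apply: (@measure_unique _ R _ _ (fun=> setT)
  (@measurable_tuple_rectangles _ (measurableTypeR R) n)
  (@tuple_rectanglesI _ _ _) _ _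
  (pushforward P (joint X)) (pushforward P (joint Y))) => //.
- by move=> _; exact: tuple_rectanglesT.
- exact: bigcup_const.
- move=> _ [B mB ->]; rewrite /= /pushforward !XE iX// iY//.
  by apply: eq_bigr => i _; apply: XY; exact: mB.
- by move=> _ /=; rewrite /pushforward preimage_setT probability_setT ltry.
Qed.

Lemma eq_integral_joint X Y (g : n.-tuple (measurableTypeR R) -> R) :
  (forall i, measurable_fun setT (X i)) ->
  (forall i, measurable_fun setT (Y i)) ->
  mutually_independent P X -> mutually_independent P Y ->
  (forall i (B : set R), measurable B -> P (X i @^-1` B) = P (Y i @^-1` B)) ->
  measurable_fun setT g ->
  P.-integrable setT (EFin \o (g \o joint X)) ->
  P.-integrable setT (EFin \o (g \o joint Y)) ->
  (\int[P]_w (g (joint X w))%:E = \int[P]_w (g (joint Y w))%:E)%E.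
Proof.
move=> mX mY iX iY XY mg igX igY.
have mgE : measurable_fun setT (EFin \o g) by exact/measurable_EFinP.
have pX := integral_pushforward (measurable_joint mX) mgE igX measurableT.
have pY := integral_pushforward (measurable_joint mY) mgE igY measurableT.
rewrite !preimage_setT in pX pY; rewrite -[LHS]pX -[RHS]pY.
apply: eq_measure_integral; [exact: measurable_joint|exact: measurable_joint|].
by move=> mjY mjX A mA _; exact: joint_law_unique.
Qed.

Definition sign_flip (s : 'I_n -> bool) X (i : 'I_n) (w : T) : R :=
  (-1) ^+ s i * X i w.

(** Flipping signs preserves independence, and also the marginals because they are symmetric; hence
    it preserves the joint law. *)
Lemma integral_sign_flip X s (g : n.-tuple (measurableTypeR R) -> R) :
  (forall i, measurable_fun setT (X i)) -> mutually_independent P X ->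
  (forall i (B : set R), measurable B ->
    P (X i @^-1` (-%R @^-1` B)) = P (X i @^-1` B)) ->
  measurable_fun setT g ->
  P.-integrable setT (EFin \o (g \o joint X)) ->
  P.-integrable setT (EFin \o (g \o joint (sign_flip s X))) ->
  (\int[P]_w (g (joint X w))%:E = \int[P]_w (g (joint (sign_flip s X) w))%:E)%E.
Proof.
move=> mX iX symX mg.
have msg b : measurable_fun setT (fun x : R => (-1) ^+ b * x).
  exact: measurable_funM.
have mflip (B : set R) b : measurable B ->
    measurable ((fun x : R => (-1) ^+ b * x) @^-1` B).
  by move=> mB; rewrite -[X in measurable X]setTI; exact: msg.
apply: eq_integral_joint => //.
- by move=> i; apply: measurable_funM.
- move=> J B mB.
  apply: (iX J (fun i => (fun x : R => (-1) ^+ s i * x) @^-1` B i)) => i.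
  exact: mflip.
- move=> i B mB; rewrite /sign_flip; case: (s i) => /=.
    under [in RHS]eq_fun do rewrite expr1 mulN1r.
    by rewrite -[LHS]symX.
  by under [in RHS]eq_fun do rewrite expr0 mul1r.
Qed.

End joint_law.

(** * The expected loss *)

Section Lfun2.
Context (d : measure_display) (T : measurableType d) (R : realType).
Variable P : probability T R.

Lemma Lfun2_of_integrable_sqr (f : T -> R) : measurable_fun setT f ->
  P.-integrable setT (EFin \o (fun w => f w ^+ 2)) -> f \in Lfun P 2%:E.
Proof.
move=> mf /integrableP[_ i2]; rewrite inE; apply/andP; split; rewrite inE//=.
rewrite /finite_norm unlock /Lnorm poweR_lty//; apply: le_lt_trans i2.
rewrite (eq_integral (fun x => `|(f x ^+ 2)%:E|%E)) ?lexx// => x _.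
by rewrite /= normrX -powR_mulrn.
Qed.

Lemma Lfun2_sub1 (f : T -> R) : f \in Lfun P 2%:E -> f \in Lfun P 1.
Proof.
apply: (Lfun_subset (lexx 1%E) (lee1n 2)); last exact: lee1n.
exact: (fin_num_measure P).
Qed.

Lemma Lfun2_sum (I : Type) (r : seq I) (F : I -> T -> R) :
  (forall i, F i \in Lfun P 2%:E) ->
  (fun w => \sum_(i <- r) F i w) \in Lfun P 2%:E.
Proof.
move=> FL; rewrite (_ : (fun _ => _) = \sum_(i <- r) F i); last first.
  by apply/funext => w; rewrite fct_sumE.
have [L0 LD] := Lfun_addr_closed P (lee1n 2).
by elim/big_ind : _ => [|f g fL gL|i _]; [exact: L0|exact: LD|exact: FL].
Qed.

Lemma Lfun2Z (c : R) (f : T -> R) : f \in Lfun P 2%:E ->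
  (fun w => c * f w) \in Lfun P 2%:E.
Proof.
move=> fL; have := (Lfun_submod_closed P (lee1n 2)).2 c f 0 fL.
by rewrite addr0; apply; exact: (Lfun_addr_closed P (lee1n 2)).1.
Qed.

Lemma Rintegral_sum (I : Type) (r : seq I) (F : I -> T -> R) :
  (forall i, P.-integrable setT (EFin \o F i)) ->
  \int[P]_w (\sum_(i <- r) F i w) = \sum_(i <- r) \int[P]_w F i w.
Proof.
move=> iF; elim: r => [|i r IH].
  rewrite big_nil; under eq_Rintegral do rewrite big_nil.
  by rewrite Rintegral_cst// mul0r.
rewrite big_cons -IH; under eq_Rintegral do rewrite big_cons.
have iS : P.-integrable setT (EFin \o (fun w => \sum_(j <- r) F j w)).
  rewrite (_ : EFin \o _ = fun w => (\sum_(j <- r) (F j w)%:E)%E).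
    by apply: integrable_sum => // j _; exact: iF.
  by apply/funext => w /=; rewrite sumEFin.
by rewrite RintegralD.
Qed.

Lemma ge0_integral_law (X : T -> R)
    (nu : {measure set (measurableTypeR R) -> \bar R}) (f : R -> \bar R) :
  measurable_fun setT X ->
  (forall B : set R, measurable B -> P (X @^-1` B) = nu B) ->
  measurable_fun setT f -> (forall x, 0 <= f x)%E ->
  (\int[P]_w f (X w) = \int[nu]_x f x)%E.
Proof.
move=> mX lawX mf f0.
pose X' : T -> measurableTypeR R := X.
have mX' : measurable_fun setT X' by [].
pose f' : measurableTypeR R -> \bar R := f.
have mf' : measurable_fun setT f' by [].
have := ge0_integral_pushforward mX' P measurableT mf' (fun y _ => f0 y).
rewrite [LHS](eq_measure_integral nu); last by move=> A mA _; rewrite -lawX.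
by rewrite preimage_setT => ->.
Qed.

End Lfun2.

(** * Moments and sign symmetry of the noise *)

Section isotropic_noise.
Context (d : measure_display) (T : measurableType d) (R : realType).
Variables (P : probability T R) (M : nat) (sigma : R) (eps : T -> 'cV[R]_M).
Hypotheses (sigma0 : 0 < sigma) (heps : isotropic_gaussian P sigma eps).

Let e (i : 'I_M) (w : T) : R := eps w i 0.

Lemma measurable_noise i : measurable_fun setT (fun w => eps w i 0).
Proof. by have [me _ _] := heps; exact: me. Qed.
Let me i : measurable_fun setT (e i). Proof. exact: measurable_noise. Qed.

Let law i (B : set R) : measurable B -> P (e i @^-1` B) = normal_prob 0 sigma B.
Proof. by have [_ + _] := heps; exact. Qed.

(** The loss contains |A eps|^4, so fourth moments must be finite; they are transported from the
    normal law. *)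
Lemma noise_sqr_Lfun2 i : (fun w => eps w i 0 ^+ 2) \in Lfun P 2%:E.
Proof.
apply: Lfun2_of_integrable_sqr; first by apply: measurable_funX; exact: me.
apply/integrableP; split.
  by apply/measurable_EFinP; do 2 apply: measurable_funX; exact: me.
have /integrableP[_] := integrable_normal_expr4 sigma0.
rewrite -(ge0_integral_law (me i) (@law i))//; last first.
  by apply: measurableT_comp => //; apply/measurable_EFinP; exact: measurable_funX.
by under eq_integral do rewrite -[4%N]/(2 * 2)%N exprM.
Qed.

Lemma noise_Lfun2 i : (fun w => eps w i 0) \in Lfun P 2%:E.
Proof.
apply: Lfun2_of_integrable_sqr; first exact: me.
exact/Lfun1_integrable/Lfun2_sub1/noise_sqr_Lfun2.
Qed.

Lemma noise_mul_Lfun2 i j : (fun w => eps w i 0 * eps w j 0) \in Lfun P 2%:E.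
Proof.
have mij : measurable_fun setT (fun w => eps w i 0 * eps w j 0).
  by apply: measurable_funM; exact: me.
apply: Lfun2_of_integrable_sqr => //.
(* The square of the product is dominated by the sum of the two fourth powers. *)
have i4 k := Lfun2_integrable_sqr (noise_sqr_Lfun2 k).
have ij := integrableD measurableT (i4 i) (i4 j).
apply: le_integrable ij => //.
  by apply/measurable_EFinP; exact: measurable_funX.
move=> w _; rewrite /= lee_fin !ger0_norm ?addr_ge0 ?sqr_ge0//.
rewrite exprMn; have := sqr_ge0 (eps w i 0 ^+ 2 - eps w j 0 ^+ 2).
have := sqr_ge0 (eps w i 0 ^+ 2); have := sqr_ge0 (eps w j 0 ^+ 2); nra.
Qed.

Lemma noise_second_moment i : \int[P]_w (eps w i 0 ^+ 2) = sigma ^+ 2.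
Proof.
rewrite /Rintegral.
rewrite (@ge0_integral_law _ _ _ _ (e i) (normal_prob 0 sigma) (fun x => (x ^+ 2)%:E))//.
- by rewrite normal_second_moment.
- exact: law.
- by apply/measurable_EFinP; exact: measurable_funX.
- by move=> x; rewrite lee_fin sqr_ge0.
Qed.

Let ind : mutually_independent P e. Proof. by have [] := heps. Qed.

Let sym i (B : set R) : measurable B ->
  P (e i @^-1` (-%R @^-1` B)) = P (e i @^-1` B).
Proof.
move=> mB; rewrite !law// ?normal_probN ?gt_eqF//.
by rewrite -[X in measurable X]setTI; exact: oppr_measurable.
Qed.

Let vec (t : M.-tuple (measurableTypeR R)) : 'cV[R]_M := \col_i tnth t i.

Lemma integral_noise_flip (s : 'I_M -> bool) (G : 'cV[R]_M -> R) :
  let flip v := \col_i ((-1) ^+ s i * v i 0) in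
  measurable_fun setT (G \o vec) ->
  P.-integrable setT (fun w => (G (eps w))%:E) ->
  P.-integrable setT (fun w => (G (flip (eps w)))%:E) ->
  \int[P]_w G (eps w) = \int[P]_w G (flip (eps w)).
Proof.
move=> flip mG iG iGf.
have E1 w : vec (joint e w) = eps w.
  by apply/colP => i; rewrite mxE tnth_mktuple.
have E2 w : vec (joint (sign_flip s e) w) = flip (eps w).
  by apply/colP => i; rewrite !mxE tnth_mktuple.
have := @integral_sign_flip _ _ _ P _ e s (G \o vec) me ind sym mG.
rewrite /comp; under eq_fun do rewrite E1; move=> /(_ iG).
under eq_fun do rewrite E2; move=> /(_ iGf).
by rewrite /Rintegral => ->.
Qed.

End isotropic_noise.

Section second_moments.
Context (d : measure_display) (T : measurableType d) (R : realType).
Variable P : probability T R.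

Lemma integrableD_EFin (f g : T -> R) :
  P.-integrable setT (EFin \o f) -> P.-integrable setT (EFin \o g) ->
  P.-integrable setT (EFin \o (fun w => f w + g w)).
Proof. by move=> fi gi; have := integrableD measurableT fi gi. Qed.

Lemma integrableZ_EFin (c : R) (f : T -> R) :
  P.-integrable setT (EFin \o f) ->
  P.-integrable setT (EFin \o (fun w => c * f w)).
Proof. by move=> fi; have := integrableZl measurableT c fi. Qed.

(** Meant for [L] linear and [Q] quadratic in the noise: the terms in [L] and [L * Q] are then odd
    and integrate to 0. *)
Lemma Rintegral_sqr_expand (a : R) (L Q : T -> R) :
  L \in Lfun P 2%:E -> Q \in Lfun P 2%:E ->
  \int[P]_w L w = 0 -> \int[P]_w (L w * Q w) = 0 ->
  \int[P]_w (a + 2 * L w + Q w) ^+ 2 =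
  a ^+ 2 + 2 * a * \int[P]_w Q w + 4 * \int[P]_w (L w ^+ 2) + \int[P]_w (Q w ^+ 2).
Proof.
move=> L2 Q2 L0 LQ0.
have iL : P.-integrable setT (EFin \o L) by exact/Lfun1_integrable/Lfun2_sub1.
have iQ : P.-integrable setT (EFin \o Q) by exact/Lfun1_integrable/Lfun2_sub1.
have iLL := Lfun2_integrable_sqr L2.
have iQQ := Lfun2_integrable_sqr Q2.
have iLQ : P.-integrable setT (EFin \o (fun w => L w * Q w)).
  exact/Lfun1_integrable/Lfun2_mul_Lfun1.
have ia : P.-integrable setT (EFin \o (fun=> a ^+ 2)).
  exact: finite_measure_integrable_cst.
pose g w := a ^+ 2 + 4 * a * L w + 2 * a * Q w + 4 * L w ^+ 2 + 4 * (L w * Q w) +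
  Q w ^+ 2.
rewrite (@eq_Rintegral _ _ _ _ _ g); last by move=> w _; rewrite /g; ring.
have i1 := integrableD_EFin ia (integrableZ_EFin (4 * a) iL).
have i2 := integrableD_EFin i1 (integrableZ_EFin (2 * a) iQ).
have i3 := integrableD_EFin i2 (integrableZ_EFin 4 iLL).
have i4 := integrableD_EFin i3 (integrableZ_EFin 4 iLQ).
rewrite /g RintegralD// RintegralD//; last exact: integrableZ_EFin.
rewrite RintegralD//; last exact: integrableZ_EFin.
rewrite RintegralD//; last exact: integrableZ_EFin.
rewrite RintegralD//; last exact: integrableZ_EFin.
rewrite Rintegral_cst// !RintegralZl// L0 LQ0.
have -> : fine (P [set: T]) = 1 by rewrite probability_setT.
ring.
Qed.

End second_moments.

(** * Algebra of the squared Euclidean norm *)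

Section enorm.
Context (R : realType).

Lemma enorm_sqr n (v : 'cV[R]_n) : enorm v ^+ 2 = \sum_i v i 0 ^+ 2.
Proof. by rewrite sqr_sqrtr// sumr_ge0// => i _; exact: sqr_ge0. Qed.

Lemma enorm_sqrE n (v : 'cV[R]_n) : enorm v ^+ 2 = (v^T *m v) 0 0.
Proof. by rewrite enorm_sqr mxE; apply: eq_bigr => i _; rewrite mxE expr2. Qed.

Lemma enorm_sqr_eq0 n (v : 'cV[R]_n) : (enorm v ^+ 2 == 0) = (v == 0).
Proof.
rewrite enorm_sqr psumr_eq0 => [|i _]; last exact: sqr_ge0.
apply/allP/eqP => [v0|-> i _]; last by rewrite mxE expr0n eqxx.
apply/colP => i; rewrite mxE; apply/eqP; rewrite -sqrf_eq0.
by rewrite (implyP (v0 i _))// mem_index_enum.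
Qed.

Lemma enorm_sqrD n (u v : 'cV[R]_n) :
  enorm (u + v) ^+ 2 = enorm u ^+ 2 + 2 * (u^T *m v) 0 0 + enorm v ^+ 2.
Proof.
have uv : (v^T *m u) 0 0 = (u^T *m v) 0 0.
  by rewrite -[in LHS](trmxK u) -trmx_mul mxE.
rewrite !enorm_sqrE mulmxDr [(u + v)^T]raddfD /= !mulmxDl.
have D (B C : 'M[R]_1) : (B + C) 0 0 = B 0 0 + C 0 0 by rewrite mxE.
by rewrite !D uv; ring.
Qed.

End enorm.

(** * Closed form of the loss *)

Section loss.
Context (d : measure_display) (T : measurableType d) (R : realType).
Variables (P : probability T R) (K M : nat) (A : 'M[R]_(K, M)).
Variables (sigma : R) (eps : T -> 'cV[R]_M) (y : 'cV[R]_M).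
Hypotheses (sigma0 : 0 < sigma) (heps : isotropic_gaussian P sigma eps).

Let lin (b v : 'cV[R]_M) : R := (b^T *m v) 0 0.
Let quad (v : 'cV[R]_M) : R := enorm (A *m v) ^+ 2.

Let linE b v : lin b v = \sum_i b i 0 * v i 0.
Proof. by rewrite /lin mxE; apply: eq_bigr => i _; rewrite mxE. Qed.

Let quadE v : quad v = \sum_k (\sum_j A k j * v j 0) ^+ 2.
Proof. by rewrite /quad enorm_sqr; apply: eq_bigr => i _; rewrite mxE. Qed.

Lemma linear_noise_Lfun2 (b : 'cV[R]_M) : (fun w => (b^T *m eps w) 0 0) \in Lfun P 2%:E.
Proof.
rewrite (_ : (fun _ => _) = fun w => \sum_(i < M) b i 0 * eps w i 0); last first.
  by apply/funext => w; rewrite -/(lin b _) linE.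
apply: Lfun2_sum => i; apply: Lfun2Z; exact: (noise_Lfun2 sigma0 heps).
Qed.

Lemma quadratic_noise_Lfun2 : (fun w => enorm (A *m eps w) ^+ 2) \in Lfun P 2%:E.
Proof.
rewrite (_ : (fun _ => _) = fun w => \sum_(k < K) \sum_(i < M) \sum_(j < M)
    (A k i * A k j) * (eps w i 0 * eps w j 0)); last first.
  apply/funext => w; rewrite -/(quad _) quadE; apply: eq_bigr => k _.
  rewrite expr2 big_distrl; apply: eq_bigr => i _ /=.
  by rewrite big_distrr; apply: eq_bigr => j _ /=; rewrite mulrACA.
do 3 apply: Lfun2_sum => ?; apply: Lfun2Z; exact: (noise_mul_Lfun2 sigma0 heps).
Qed.

Let vec (t : M.-tuple (measurableTypeR R)) : 'cV[R]_M := \col_i tnth t i.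

Let mlin b : measurable_fun setT (lin b \o vec).
Proof.
rewrite (_ : _ \o _ = fun t => \sum_i b i 0 * tnth t i); last first.
  by apply/funext => t /=; rewrite linE; apply: eq_bigr => i _; rewrite mxE.
apply: measurable_sum => i; apply: measurable_funM => //.
exact: measurable_tnth.
Qed.

Let mquad : measurable_fun setT (quad \o vec).
Proof.
rewrite (_ : _ \o _ = fun t => \sum_k (\sum_j A k j * tnth t j) ^+ 2); last first.
  apply/funext => t /=; rewrite quadE; apply: eq_bigr => k _; congr (_ ^+ 2).
  by apply: eq_bigr => i _; rewrite mxE.
apply: measurable_sum => k; apply: measurable_funX; apply: measurable_sum => i.
by apply: measurable_funM => //; exact: measurable_tnth.
Qed.

(** Flipping all signs preserves the law of the noise and negates [G], so the integral equals its
    own opposite. *)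
Lemma odd_noise_integral (G : 'cV[R]_M -> R) :
  measurable_fun setT (fun t : M.-tuple (measurableTypeR R) => G (\col_i tnth t i)) ->
  P.-integrable setT (EFin \o (fun w => G (eps w))) ->
  (forall v : 'cV[R]_M, G (- v) = - G v) ->
  \int[P]_w G (eps w) = 0.
Proof.
move=> mG iG oddG.
have flipE (v : 'cV[R]_M) : \col_i ((-1) ^+ (fun=> true) i * v i 0) = - v.
  by apply/colP => i; rewrite !mxE /= expr1 mulN1r.
have GN w : G (\col_i ((-1) ^+ (fun=> true) i * eps w i 0)) = -1 * G (eps w).
  by rewrite flipE oddG mulN1r.
have h := integral_noise_flip sigma0 heps (s := fun=> true) mG iG.
suff : \int[P]_w G (eps w) = -1 * \int[P]_w G (eps w) by lra.
rewrite [LHS]h; last first.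
  under eq_fun do rewrite GN.
  exact: integrableZ_EFin.
under eq_Rintegral do rewrite GN.
by rewrite RintegralZl.
Qed.

Lemma noise_covariance i j :
  \int[P]_w (eps w i 0 * eps w j 0) = sigma ^+ 2 *+ (i == j).
Proof.
have [->|ij] := eqVneq i j.
  by under eq_Rintegral do rewrite -expr2; exact: (noise_second_moment sigma0 heps).
pose G (v : 'cV[R]_M) := v i 0 * v j 0.
have mG : measurable_fun setT (G \o vec).
  rewrite (_ : _ \o _ = fun t => tnth t i * tnth t j); last first.
    by apply/funext => t /=; rewrite /G !mxE.
  by apply: measurable_funM; exact: measurable_tnth.
have iG : P.-integrable setT (EFin \o (fun w => G (eps w))).
  exact/Lfun1_integrable/Lfun2_sub1/(noise_mul_Lfun2 sigma0 heps).
(* Flipping coordinate [i] alone negates the product, as [j] differs from [i]. *)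
have GN w : G (\col_k ((-1) ^+ pred1 i k * eps w k 0)) = -1 * G (eps w).
  by rewrite /G !mxE /= eqxx [j == i]eq_sym (negbTE ij) expr1 expr0 mul1r mulrA.
have h := integral_noise_flip sigma0 heps (s := pred1 i) mG iG.
rewrite mulr0n -[LHS]/(\int[P]_w G (eps w)).
suff : \int[P]_w G (eps w) = -1 * \int[P]_w G (eps w) by lra.
rewrite [LHS]h; last first.
  under eq_fun do rewrite GN.
  exact: integrableZ_EFin.
under eq_Rintegral do rewrite GN.
by rewrite RintegralZl.
Qed.

Lemma linear_noise_variance (b : 'cV[R]_M) :
  \int[P]_w ((b^T *m eps w) 0 0 ^+ 2) = sigma ^+ 2 * enorm b ^+ 2.
Proof.
have i2 i j : P.-integrable setT (EFin \o (fun w => eps w i 0 * eps w j 0)).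
  exact/Lfun1_integrable/Lfun2_sub1/(noise_mul_Lfun2 sigma0 heps).
rewrite (@eq_Rintegral _ _ _ _ _ (fun w => \sum_(p : 'I_M * 'I_M)
    b p.1 0 * b p.2 0 * (eps w p.1 0 * eps w p.2 0))); last first.
  move=> w _; rewrite -/(lin b _) linE expr2 big_distrl/=.
  rewrite -(pair_bigA _ (fun i j => b i 0 * b j 0 * (eps w i 0 * eps w j 0)))/=.
  apply: eq_bigr => i _; rewrite big_distrr/=; apply: eq_bigr => j _.
  by rewrite mulrACA.
rewrite Rintegral_sum; last by move=> p; exact: integrableZ_EFin.
under eq_bigr do rewrite RintegralZl// noise_covariance.
rewrite -(pair_bigA _ (fun i j => b i 0 * b j 0 * (sigma ^+ 2 *+ (i == j))))/=.
rewrite enorm_sqr mulr_sumr; apply: eq_bigr => i _.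
rewrite (bigD1 i)//= eqxx big1 ?addr0 => [|j ji].
  by rewrite mulr1n mulrC expr2.
by rewrite eq_sym (negbTE ji) mulr0n mulr0.
Qed.

Lemma loss_decomposition : exists K0, forall x,
  loss P A eps y x =
  (enorm (A *m x) ^+ 2 - (enorm (A *m y) ^+ 2 - noise_energy P A eps)) ^+ 2 +
  4 * sigma ^+ 2 * enorm (A^T *m A *m x) ^+ 2 + K0.
Proof.
(* The constant is the variance of Q = |A eps|^2, left over when a^2 + 2 a E[Q] + E[Q^2] is
   completed to (a + E[Q])^2. *)
exists (\int[P]_w (quad (eps w) ^+ 2) - (\int[P]_w quad (eps w)) ^+ 2) => x.
rewrite /loss /noise_energy unlock -!/(Rintegral _ _ _).
pose b := A^T *m A *m x; pose a := enorm (A *m x) ^+ 2 - enorm (A *m y) ^+ 2.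
rewrite (@eq_Rintegral _ _ _ _ _
    (fun w => (a + 2 * lin b (eps w) + quad (eps w)) ^+ 2)); last first.
  move=> w _; congr (_ ^+ 2); rewrite mulmxDr enorm_sqrD /a /lin /quad.
  (* The cross term is the inner product of Ax and A eps, which is that of A^T A x and eps; hence
     the choice of [b]. *)
  have -> : b^T *m eps w = (A *m x)^T *m (A *m eps w).
    by rewrite /b !trmx_mul trmxK !mulmxA.
  ring.
have L2 := linear_noise_Lfun2 b.
have Q2 := quadratic_noise_Lfun2.
have linN v : lin b (- v) = - lin b v by rewrite /lin mulmxN mxE.
have quadN v : quad (- v) = quad v.
  by rewrite /quad mulmxN !enorm_sqr; apply: eq_bigr => i _; rewrite mxE sqrrN.
rewrite Rintegral_sqr_expand//.
- rewrite linear_noise_variance -/b /a; ring.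
- apply: odd_noise_integral => //; first exact: mlin.
  exact/Lfun1_integrable/Lfun2_sub1.
- apply: (@odd_noise_integral (fun v => lin b v * quad v)).
  + exact: measurable_funM (mlin b) mquad.
  + exact/Lfun1_integrable/Lfun2_mul_Lfun1.
  + by move=> v; rewrite linN quadN mulNr.
Qed.

End loss.

(** * The smallest eigenvalue of a Gram matrix *)

Section smallest_eigenvalue.
Context (R : realType) (K M : nat) (A : 'M[R]_(K, M)).
Local Notation S := (A^T *m A).

Lemma enorm_sqrZ n (c : R) (v : 'cV[R]_n) :
  enorm (c *: v) ^+ 2 = c ^+ 2 * enorm v ^+ 2.
Proof.
rewrite !enorm_sqr mulr_sumr; apply: eq_bigr => i _.
by rewrite mxE exprMn.
Qed.

Lemma gram_form (x v : 'cV[R]_M) :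
  (x^T *m (S *m v)) 0 0 = ((A *m x)^T *m (A *m v)) 0 0.
Proof. by rewrite trmx_mul !mulmxA. Qed.

Lemma continuous_enorm_sqr_mul n (B : 'M[R]_(n, M)) :
  continuous (fun v : 'rV[R]_M => enorm (B *m v^T) ^+ 2).
Proof.
have -> : (fun v : 'rV[R]_M => enorm (B *m v^T) ^+ 2) =
    fun v => \sum_k (\sum_j B k j * v 0 j) ^+ 2.
  apply/funext => v; rewrite enorm_sqr; apply: eq_bigr => k _.
  by rewrite mxE; congr (_ ^+ 2); apply: eq_bigr => j _; rewrite mxE.
apply: continuous_big => [|k _]; first exact: add_continuous.
have lin_cont i : continuous (fun v : 'rV[R]_M => \sum_j B i j * v 0 j).
  apply: continuous_big => [|j _]; first exact: add_continuous.
  by move=> v; apply: continuousM; [exact: cst_continuous|exact: coord_continuous].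
under eq_fun do rewrite expr2.
by move=> v; apply: continuousM; exact: lin_cont.
Qed.

(** Row vectors are used because [EVT_min_rV] is applied to this set. *)
Definition unit_sphere : set 'rV[R]_M := [set v | enorm v^T ^+ 2 = 1].

(** Bounded because the sup norm is at most the Euclidean one, and closed as the preimage of 1 under
    a continuous map. *)
Lemma compact_unit_sphere : compact unit_sphere.
Proof.
apply: bounded_closed_compact.
- exists 1; split => // r r1 v v1; apply: le_trans (ltW r1).
  rewrite [leLHS]mx_normrE; apply/bigmax_leP; split => //= -[i j] _ /=.
  rewrite ord1 -(@ler_pXn2r _ 2)// ?nnegrE// expr1n real_normK ?num_real//.
  rewrite -v1 enorm_sqr (bigD1 j)//= mxE lerDl sumr_ge0// => k _.
  exact: sqr_ge0.
- have -> : unit_sphere = (fun v : 'rV[R]_M => enorm (1%:M *m v^T) ^+ 2) @^-1` [set 1].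
    by apply/seteqP; split => v /=; rewrite mul1mx.
  apply: preimage_closed; last exact: closed_eq.
  by move=> v _; exact: continuous_enorm_sqr_mul.
Qed.

(* The minimum [l] of [enorm (A *m v) ^+ 2] on the unit sphere makes
   [q v = enorm (A *m v) ^+ 2 - l * enorm v ^+ 2] a nonnegative quadratic form
   vanishing at the minimizer, which is therefore a critical point of [q]. *)
Lemma exists_smallest_eigenvector : (0 < M)%N ->
  exists l : R, exists u : 'cV[R]_M,
    [/\ u != 0, S *m u = l *: u &
        forall v : 'cV[R]_M, l * enorm v ^+ 2 <= enorm (A *m v) ^+ 2].
Proof.
move=> M0.
have [w wS wmin] : exists2 w, w \in unit_sphere &
    forall v, v \in unit_sphere -> enorm (A *m w^T) ^+ 2 <= enorm (A *m v^T) ^+ 2.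
  apply: (EVT_min_rV (f := fun v => enorm (A *m v^T) ^+ 2)) => //.
  - exists (delta_mx 0 (Ordinal M0)); rewrite /unit_sphere /= enorm_sqr.
    rewrite (bigD1 (Ordinal M0))//= big1 => [|i ni].
      by rewrite !mxE !eqxx expr1n addr0.
    by rewrite !mxE (negbTE ni) expr0n.
  - exact: compact_unit_sphere.
  - apply: continuous_subspaceT => v; exact: continuous_enorm_sqr_mul.
have [u u1 umin] : exists2 u : 'cV[R]_M, enorm u ^+ 2 = 1 &
    forall v : 'cV[R]_M, enorm v ^+ 2 = 1 ->
      enorm (A *m u) ^+ 2 <= enorm (A *m v) ^+ 2.
  exists w^T; first by move: wS; rewrite inE.
  by move=> v v1; rewrite -[v]trmxK wmin// inE /unit_sphere/= trmxK.
have [l lE] : exists l, enorm (A *m u) ^+ 2 = l by exists (enorm (A *m u) ^+ 2).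
(* Both sides are homogeneous of degree 2, so normalizing [v] reduces to the sphere. *)
have lmin (v : 'cV[R]_M) : l * enorm v ^+ 2 <= enorm (A *m v) ^+ 2.
  have [->|v0] := eqVneq v 0.
    by rewrite mulmx0 !enorm_sqr !big1 ?mulr0// => i _; rewrite mxE expr0n.
  have nv : 0 < enorm v ^+ 2 by rewrite lt_neqAle eq_sym enorm_sqr_eq0 v0 sqr_ge0.
  rewrite -ler_pdivlMr// -lE.
  have := umin ((enorm v)^-1 *: v).
  rewrite -scalemxAr !enorm_sqrZ exprVn [_ * enorm (A *m v) ^+ 2]mulrC; apply.
  by rewrite mulVf ?gt_eqF.
exists l, u; split => //; first by rewrite -enorm_sqr_eq0 u1 oner_eq0.
(* Half the gradient of [q] at [u]; the goal is that it vanishes. *)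
pose r : 'cV[R]_M := S *m u - l *: u.
pose q (v : 'cV[R]_M) := enorm (A *m v) ^+ 2 - l * enorm v ^+ 2.
have q0 v : 0 <= q v by rewrite subr_ge0.
have rE : ((A *m u)^T *m (A *m r)) 0 0 - l * (u^T *m r) 0 0 = enorm r ^+ 2.
  have rT : r^T = (S *m u)^T - l *: u^T by rewrite /r linearB linearZ.
  rewrite enorm_sqrE rT mulmxBl -scalemxAl !trmx_mul trmxK !mulmxA.
  by move: (_ *m r) (_ *m r) => B C; rewrite !mxE.
have mZ (c : R) (B : 'M[R]_1) : (c *: B) 0 0 = c * B 0 0 by rewrite mxE.
(* There is no constant term, because q(u) = 0. *)
have qE c (v : 'cV[R]_M) : q (u + c *: v) = c ^+ 2 * q v +
    2 * c * (((A *m u)^T *m (A *m v)) 0 0 - l * (u^T *m v) 0 0).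
  rewrite /q mulmxDr -scalemxAr !enorm_sqrD !enorm_sqrZ lE u1.
  rewrite -!scalemxAr !mZ; ring.
apply/eqP; rewrite -subr_eq0 -/r -enorm_sqr_eq0; apply/negPn/negP => r0.
have rp : 0 < enorm r ^+ 2 by rewrite lt_neqAle eq_sym r0 sqr_ge0.
(* Descent step: q(u - t r) = t^2 q(r) - 2 t |r|^2 = - t^2 - t |r|^2 < 0, a contradiction. The 1
   keeps the denominator positive when q(r) = 0. *)
pose t := enorm r ^+ 2 / (q r + 1).
have q1 : 0 < q r + 1 by rewrite ltr_wpDl.
have t0 : 0 < t by rewrite divr_gt0.
have := q0 (u + (- t) *: r); rewrite qE rE.
have tq : t * (q r + 1) = enorm r ^+ 2 by rewrite divfK// gt_eqF.
have := q0 r; nra.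
Qed.

(** [eigenvalue] refers to row eigenvectors; symmetry of the Gram matrix lets one transpose them. *)
Lemma eigenvalue_gramP (l : R) :
  eigenvalue S l <-> exists2 u : 'cV[R]_M, S *m u = l *: u & u != 0.
Proof.
have ST : S^T = S by rewrite trmx_mul trmxK.
split=> [/eigenvalueP[v vS v0]|[u uS u0]].
  exists v^T; last by rewrite trmx_eq0.
  by rewrite -{1}ST -trmx_mul vS linearZ.
apply/eigenvalueP; exists u^T; last by rewrite trmx_eq0.
by rewrite -{1}ST -trmx_mul uS linearZ.
Qed.

Lemma gram_eigenvector_enorm (l : R) (u : 'cV[R]_M) : S *m u = l *: u ->
  enorm (A *m u) ^+ 2 = l * enorm u ^+ 2.
Proof.
by move=> uS; rewrite !enorm_sqrE -gram_form uS -scalemxAr mxE.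
Qed.

(* [enorm (S *m x) ^+ 2 - l * enorm (A *m x) ^+ 2] is
   [enorm ((S - l) x) ^+ 2 + l * (enorm (A *m x) ^+ 2 - l * enorm x ^+ 2)]. *)
Lemma gram_sqr_gap (l : R) (x : 'cV[R]_M) : 0 < l ->
  l * enorm x ^+ 2 <= enorm (A *m x) ^+ 2 ->
  l * enorm (A *m x) ^+ 2 <= enorm (S *m x) ^+ 2 ?= iff (S *m x == l *: x).
Proof.
move=> l0 lx.
have E : enorm (S *m x) ^+ 2 = enorm (S *m x - l *: x) ^+ 2 +
    2 * l * enorm (A *m x) ^+ 2 - l ^+ 2 * enorm x ^+ 2.
  rewrite enorm_sqrD -scaleNr enorm_sqrZ -scalemxAr mxE.
  have -> : ((S *m x)^T *m x) 0 0 = enorm (A *m x) ^+ 2.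
    by rewrite enorm_sqrE -gram_form !trmx_mul trmxK !mulmxA.
  ring.
have l2 : 0 <= l * (enorm (A *m x) ^+ 2 - l * enorm x ^+ 2).
  by rewrite mulr_ge0 ?subr_ge0// ltW.
split; first by have := sqr_ge0 (enorm (S *m x - l *: x)); nra.
apply/eqP/eqP => [h|h].
  apply/eqP; rewrite -subr_eq0 -enorm_sqr_eq0.
  have := sqr_ge0 (enorm (S *m x - l *: x)); rewrite eq_le => -> /=; nra.
rewrite h enorm_sqrZ (gram_eigenvector_enorm h); ring.
Qed.

End smallest_eigenvalue.

(** * Minimizers of the loss *)

Theorem proposition2p3 (R : realType) (K' M : nat) (A : 'M[R]_(K', M))
    (hA : injective (fun x : 'cV[R]_M => A *m x))
    (sigma : R) (hsigma : 0 < sigma) (y : 'cV[R]_M)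
    (d : measure_display) (T : measurableType d) (P : probability T R)
    (eps : T -> 'cV[R]_M) (heps : isotropic_gaussian P sigma eps) :
  (Lambda P A sigma eps y = set0 ->
     global_minimizers (loss P A eps y) = [set 0]) /\
  (Lambda P A sigma eps y <> set0 ->
     exists2 lmin : R, is_min (Lambda P A sigma eps y) lmin &
       global_minimizers (loss P A eps y) =
       [set x | A^T *m A *m x = lmin *: x /\
                enorm (A *m x) ^+ 2 =
                enorm (A *m y) ^+ 2 - noise_energy P A eps
                  - 2 * sigma ^+ 2 * lmin]).
Proof.
have [K0 lossE] := loss_decomposition A y hsigma heps.
set t := enorm (A *m y) ^+ 2 - noise_energy P A eps in lossE *.
have A0 (x : 'cV[R]_M) : enorm (A *m x) ^+ 2 = 0 -> x = 0.
  by move=> /eqP; rewrite enorm_sqr_eq0 => /eqP Ax; apply: hA; rewrite mulmx0.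
(* For M = 0 the space is a single point and there are no eigenvalues, so [Lambda] is empty. *)
have [M0|Mpos] := posnP M.
  have x0 (x : 'cV[R]_M) : x = 0.
    by apply/colP => -[i iM]; exfalso; rewrite M0 in iM.
  split=> [_|L0].
    by apply/seteqP; split=> x _ /=; [exact: x0|move=> z; rewrite (x0 x) (x0 z)].
  exfalso; apply: L0; apply/seteqP; split=> // l [/eigenvalue_gramP[u _ /eqP u0] _].
  by case: (u0 (x0 u)).
have [l [u [u0 Su lmin]]] := exists_smallest_eigenvector A Mpos.
have eu0 : 0 < enorm u ^+ 2 by rewrite lt_neqAle eq_sym enorm_sqr_eq0 u0 sqr_ge0.
have Au0 : 0 < enorm (A *m u) ^+ 2.
  rewrite lt_neqAle sqr_ge0 andbT eq_sym; apply/eqP => /A0 uz.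
  by rewrite uz eqxx in u0.
have l0 : 0 < l by move: Au0; rewrite (gram_eigenvector_enorm Su) pmulr_lgt0.
have s20 : 0 < sigma ^+ 2 by rewrite exprn_gt0.
have spl : eigenvalue (A^T *m A) l by apply/eigenvalue_gramP; exists u.
have lle l' : eigenvalue (A^T *m A) l' -> l <= l'.
  move=> /eigenvalue_gramP[v Sv v0].
  have ev0 : 0 < enorm v ^+ 2 by rewrite lt_neqAle eq_sym enorm_sqr_eq0 v0 sqr_ge0.
  by rewrite -(ler_pM2r ev0) -(gram_eigenvector_enorm Sv).
have gap x := gram_sqr_gap l0 (lmin x).
split=> [L0|Lne].
  have tl : t < 2 * sigma ^+ 2 * l.
    rewrite ltNge; apply/negP => tl.
    suff : Lambda P A sigma eps y l by rewrite L0.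
    by split=> //; rewrite subr_ge0.
  have loss0 : loss P A eps y 0 = t ^+ 2 + K0.
    rewrite lossE !mulmx0 !enorm_sqr !big1 => [|i _|i _]; rewrite ?mxE ?expr0n//.
    by rewrite sub0r sqrrN mulr0 addr0.
  (* With u = |Ax|^2, the difference is at least u^2 + 2 u (2 sigma^2 l - t), and the bracket is
     positive. At a minimizer this forces u = 0. *)
  have lossB x : loss P A eps y x - loss P A eps y 0 >=
      enorm (A *m x) ^+ 2 * enorm (A *m x) ^+ 2.
    rewrite loss0 lossE; have [gx _] := gap x.
    have ax := sqr_ge0 (enorm (A *m x)); have := ler_wpM2l (ltW s20) gx.
    have := mulr_ge0 ax (ltW (etrans (subr_gt0 _ _) tl)); nra.
  apply/seteqP; split=> [x xmin|_ -> z] /=.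
    apply: A0; apply/eqP; rewrite -[_ == 0]sqrf_eq0 eq_le sqr_ge0 andbT.
    by rewrite expr2 (le_trans (lossB x))// subr_le0.
  by rewrite -subr_ge0 (le_trans _ (lossB z))// mulr_ge0 ?sqr_ge0.
(* The defining inequality of [Lambda] is inherited by smaller eigenvalues, so [l] belongs to
   [Lambda] as soon as some eigenvalue does. *)
have tl : 0 <= t - 2 * sigma ^+ 2 * l.
  have /set0P[l' [/lle ll' tl']] : Lambda P A sigma eps y != set0 by exact/eqP.
  by rewrite (le_trans tl')// lerB// ler_wpM2l//; lra.
exists l; first by split=> [|l' [/lle]].
set r := t - 2 * sigma ^+ 2 * l in tl *.
(* Completing the square: (u - t)^2 + 4 sigma^2 l u = (u - r)^2 + t^2 - r^2. *)
have lossE' x : loss P A eps y x =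
    (enorm (A *m x) ^+ 2 - r) ^+ 2 +
    4 * sigma ^+ 2 * (enorm (A^T *m A *m x) ^+ 2 - l * enorm (A *m x) ^+ 2) +
    (t ^+ 2 - r ^+ 2 + K0).
  by rewrite lossE /r; ring.
have gap0 x : 0 <= 4 * sigma ^+ 2 *
    (enorm (A^T *m A *m x) ^+ 2 - l * enorm (A *m x) ^+ 2).
  by have [gx _] := gap x; rewrite mulr_ge0 ?subr_ge0 ?mulr_ge0// ltW.
have optE x : A^T *m A *m x = l *: x -> enorm (A *m x) ^+ 2 = r ->
    loss P A eps y x = t ^+ 2 - r ^+ 2 + K0.
  move=> Sx Ax; have [_ /esym] := gap x; rewrite Sx eqxx => /esym/eqP gx.
  by rewrite lossE' Sx gx Ax; ring.
apply/seteqP; split=> [x xmin|x [Sx Ax] z] /=.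
  (* Scales the eigenvector [u] so that |A (c u)|^2 = r, which is possible since r >= 0; this point
     attains the lower bound. *)
  pose c := Num.sqrt (r / enorm (A *m u) ^+ 2).
  have := xmin (c *: u); rewrite [X in _ <= X]optE; last 2 first.
  - by rewrite -scalemxAr Su scalerA mulrC -scalerA.
  - rewrite -scalemxAr enorm_sqrZ sqr_sqrtr ?divfK ?gt_eqF//.
    by rewrite divr_ge0// ltW.
  (* Now two nonnegative terms have a nonpositive sum, so each vanishes: one gives the eigenvector
     equation, the other |Ax|^2 = r. *)
  rewrite lossE' gerDr => le0.
  have := gap0 x; have := sqr_ge0 (enorm (A *m x) ^+ 2 - r) => h1 h2.
  split.
    apply/eqP; have [_ <-] := gap x; rewrite eq_sym -subr_eq0.
    have : 4 * sigma ^+ 2 *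
        (enorm (A^T *m A *m x) ^+ 2 - l * enorm (A *m x) ^+ 2) == 0.
      by rewrite eq_le h2 andbT; lra.
    by rewrite mulf_eq0 (gt_eqF (mulr_gt0 _ s20)).
  apply/eqP; rewrite -subr_eq0 -sqrf_eq0 eq_le h1 andbT; lra.
by rewrite optE// lossE' lerDr addr_ge0 ?sqr_ge0.
Qed.
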